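(* Let $L\in\mathbb{R}^{n\times n}$ be a Laplacian matrix and $\bar J=L^\vdash$ its eigenprojection. Let $\boldsymbol v=(v_1,\ldots,v_n)^{\mathrm T}$ satisfy $v_i\ge0$ for all $i$ and $\sum_{i=1}^n v_i=1$, and let $D=I-\mathbf 1\boldsymbol v^{\mathrm T}$. For $\delta>0$ let $\boldsymbol x(t)$, $t\ge0$, be the solution of $$\dot{\boldsymbol x}(t)=-(L+\delta D)\,\boldsymbol x(t)$$ with initial state $\boldsymbol x(0)\in\mathbb R^n$ (fixed independently of $\delta$). Then: 1. $\displaystyle\lim_{t\to\infty}\boldsymbol x(t)=\mathbf 1\boldsymbol v^{\mathrm T}\big(I+\tfrac1\delta L\big)^{-1}\boldsymbol x(0)$; 2. $\displaystyle\lim_{\delta\to+0}\lim_{t\to\infty}\boldsymbol x(t)=\mathbf 1\boldsymbol v^{\mathrm T}\bar J\,\boldsymbol x(0)$.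
   Context: A Laplacian matrix is a real square matrix with nonpositive off-diagonal entries and zero row sums. For a square matrix $A$ let $\nu$ be its index, i.e. the smallest $k\in\{0,1,\ldots\}$ with $\operatorname{rank}A^{k+1}=\operatorname{rank}A^k$ (where $A^0=I$); the eigenprojection $A^\vdash$ of $A$ (corresponding to the eigenvalue $0$) is the unique idempotent matrix with range $\mathcal R(A^\vdash)=\mathcal N(A^\nu)$ and null space $\mathcal N(A^\vdash)=\mathcal R(A^\nu)$. $\mathbf 1$ is the all-ones column vector of length $n$ and $I$ is the identity matrix of order $n$. *)

(* Defs.v *)
From mathcomp Require Import all_boot all_order all_algebra.
From mathcomp Require Import all_classical all_reals all_analysis.

Set Implicit Arguments.
Unset Strict Implicit.
Unset Printing Implicit Defensive.

Import Order.TTheory GRing.Theory Num.Theory.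
Import numFieldNormedType.Exports.

Local Open Scope classical_set_scope.
Local Open Scope ring_scope.

Definition laplacian (R : realType) (n : nat) (L : 'M[R]_n) : Prop :=
  (forall i j, i != j -> L i j <= 0) /\ (forall i, \sum_j L i j = 0).

Lemma index_subproof (F : fieldType) (n : nat) (A : 'M[F]_n) :
  exists k : nat, \rank (A ^+ k.+1) == \rank (A ^+ k).
Proof.
apply: contrapT => /forallNP noidx.
suff rank_le k : (\rank (A ^+ k) + k <= n)%N.
  by have := leq_trans (leq_addl _ _) (rank_le n.+1); rewrite ltnn.
elim: k => [|k IHk]; first by rewrite addn0 rank_leq_row.
apply: leq_trans IHk; rewrite addnS -addSn leq_add2r ltn_neqAle.
apply/andP; split; first exact/negP/noidx.
rewrite exprS; exact: (mxrankM_maxr A (A ^+ k)).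
Qed.

Definition mxindex (F : fieldType) (n : nat) (A : 'M[F]_n) : nat :=
  ex_minn (index_subproof A).

(* Matrices act on column vectors here, so range and null space are the
   column-vector ones, not the row spaces of [kermx] and [(_ <= _)%MS]. *)
Definition mxrange (F : fieldType) (n : nat) (A : 'M[F]_n) : set 'cV[F]_n :=
  [set A *m y | y in [set: 'cV[F]_n]].

Definition mxnull (F : fieldType) (n : nat) (A : 'M[F]_n) : set 'cV[F]_n :=
  [set y | A *m y = 0].

Definition eigenprojection (F : fieldType) (n : nat) (A P : 'M[F]_n) : Prop :=
  [/\ P *m P = P,
      mxrange P = mxnull (A ^+ mxindex A) &
      mxnull P = mxrange (A ^+ mxindex A)].

Definition ones (R : realType) (n : nat) : 'cV[R]_n := const_mx 1.
Arguments ones {R n}.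

(* [x] solves x' = M x on [0, +oo[ with x 0 = x0; the values of [x] at negative
   times are irrelevant, and the derivative at 0 is the right one. *)
Definition linear_ode_solution (R : realType) (n : nat) (M : 'M[R]_n)
    (x0 : 'cV[R]_n) (x : R -> 'cV[R]_n) : Prop :=
  [/\ x 0 = x0,
      (h^-1 *: (x h - x 0)) @[h --> 0^'+] --> M *m x 0 &
      forall t : R, 0 < t -> is_derive t 1 x (M *m x t)].

(* Main.v *)
(* The row [w = v^T (I + L / delta)^-1] satisfies [w (L + delta D) = 0] and
   [w 1 = 1], so [w x(t)] is conserved. By the maximum principle for [L], the
   differences [x_i - x_j] decay like [exp (- delta t)], hence every [x_i]
   converges to the conserved quantity [w x(0)]. As delta tends to 0, the
   resolvents [(I + L / delta)^-1] are bounded (maximum principle again), fix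
   the null space of [L] and tend to 0 on its range. Therefore
   [L^2 y = 0] implies [L y = 0], and the resolvents tend to [J]. *)
Require Import Defs.
From mathcomp Require Import all_boot all_order all_algebra.
From mathcomp Require Import all_classical all_reals all_analysis.
From mathcomp Require Import ring lra.

Import Order.TTheory GRing.Theory Num.Theory.
Import numFieldNormedType.Exports.

Local Open Scope classical_set_scope.
Local Open Scope ring_scope.

(** * Entrywise limits of matrices *)

Lemma cvg_mx (R : realType) (m n : nat) (T : Type) (F : set_system T)
    (FF : Filter F) (M : T -> 'M[R]_(m, n)) (N : 'M[R]_(m, n)) :
  (forall i j, M t i j @[t --> F] --> N i j) -> M t @[t --> F] --> N.
Proof.
move=> MN; apply/cvg_ballP => e e0.
have : \forall t \near F, forall i j, ball (N i j) e (M t i j).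
  apply: filter_forall => i; apply: filter_forall => j.
  by have /cvg_ballP := MN i j; exact.
by apply: filterS => t Mt; split.
Qed.

Lemma cvg_entry (R : realType) (m n : nat) (T : Type) (F : set_system T)
    (FF : Filter F) (M : T -> 'M[R]_(m, n)) (N : 'M[R]_(m, n)) i j :
  M t @[t --> F] --> N -> M t i j @[t --> F] --> N i j.
Proof.
move=> MN; apply: (cvg_comp M (fun A : 'M[R]_(m, n) => A i j)) MN _.
exact: coord_continuous.
Qed.

Lemma cvg_mulmx (R : realType) (m n p : nat) (T : Type) (F : set_system T)
    (FF : Filter F) (A : 'M[R]_(m, n)) (M : T -> 'M[R]_(n, p))
    (N : 'M[R]_(n, p)) :
  M t @[t --> F] --> N -> A *m M t @[t --> F] --> A *m N.
Proof.
move=> MN; apply: cvg_mx => i j; rewrite [X in _ --> X]mxE.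
under eq_fun do rewrite mxE.
apply: cvg_big => [|k _]; first exact: add_continuous.
by apply: cvgMr; exact: cvg_entry.
Qed.

(** * A maximum principle with exponential decay *)

(** For small [h < 0] the difference quotient has nonpositive numerator and negative denominator.
    Only times before [c] are compared, so [c] may be the right end of an interval. *)
Lemma derive_at_left_max (R : realType) (f : R -> R) (a c : R) :
  a < c -> derivable f c 1 -> (forall t, a < t < c -> f t <= f c) ->
  0 <= 'D_1 f c.
Proof.
move=> ac dfc fmax.
have /cvg_dnbhs_at_left dl :
    h^-1 *: ((f \o shift c) (h *: 1) - f c) @[h --> 0^'] --> 'D_1 f c by exact: dfc.
rewrite -(cvg_lim _ dl)//; apply: limr_ge; first exact: cvgP dl.
near=> h; have h0 : h < 0 by [].
apply: mulr_le0; first by rewrite invr_le0 ltW.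
rewrite subr_le0 [_%:A]mulr1; apply: fmax => /=.
rewrite gtrDr h0 andbT -ltrBlDr.
by near: h; apply: nbhs_left_gt; rewrite subr_lt0.
Unshelve. all: by end_near. Qed.

(* Where the weighted function [expR (d t) u i t - e t] attains its maximum over
   all [i] and all [t] in an interval, its left derivative would be negative,
   unless the maximum is attained at time 0. *)
Lemma max_expR_decay (R : realType) (I : finType) (u du : I -> R -> R)
    (d C : R) :
  (forall i, u i s @[s --> 0^'+] --> u i 0) ->
  (forall (i : I) (t : R), 0 < t -> is_derive t 1 (u i) (du i t)) ->
  (forall (i : I) (t : R), 0 < t -> (forall k, u k t <= u i t) ->
    du i t <= - d * u i t) ->
  (forall i, u i 0 <= C) ->
  forall (i : I) (t : R), 0 <= t -> u i t <= C * expR (- d * t).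
Proof.
move=> u0 dudt decay uC i t; rewrite le_eqVlt => /predU1P[<-|t0].
  by rewrite mulr0 expR0 mulr1.
rewrite mulNr expRN ler_pdivlMr ?expR_gt0//.
apply/ler_addgt0Pr => e e0.
(* The tilt [eps * s] costs exactly [e] at time [t], and it makes the derivative at a positive
   maximum point strictly negative. *)
pose eps := e / t; have eps0 : 0 < eps by rewrite divr_gt0.
pose g k (s : R) := expR (d * s) * u k s - eps * s.
have dg (k : I) (s : R) : 0 < s ->
    is_derive s 1 (g k) (expR (d * s) * (d * u k s + du k s) - eps).
  move=> s0; have := dudt k s s0 => dk.
  rewrite /g; apply: is_derive_eq; rewrite /GRing.scale/=.
  ring.
have g_max k : exists c, c \in `[0, t] /\ forall s, s \in `[0, t] -> g k s <= g k c.
  have [||c cI cmax] := @EVT_max _ (g k) 0 t; [exact: ltW| |by exists c].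
  have gcont (s : R) : 0 < s -> {for s, continuous (g k)}.
    move=> s0; apply: differentiable_continuous; apply/derivable1_diffP.
    by have [] := dg k s s0.
  apply/continuous_within_itvP => //; split.
  - by move=> s; rewrite in_itv/= => /andP[s0 _]; exact: gcont.
  - rewrite /g; apply: cvgB; last first.
      by apply: cvgMr; apply: cvg_at_right_filter; exact: cvg_id.
    apply: cvgM; last exact: u0.
    apply: cvg_at_right_filter; apply: (@cvg_comp _ _ _ ( *%R d) expR).
      by apply: mulrl_continuous.
    exact: continuous_expR.
  - by apply: cvg_at_left_filter; exact: gcont.
(* Each index has its own maximum point [c k]; the best of these finitely many values is the joint
   maximum over indices and times. *)
have /choice[c cP] := g_max.
have [/= k _ kmax] := @arg_maxP _ _ _ i xpredT (fun k => g k (c k)) isT.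
have gmax j s : s \in `[0, t] -> g j s <= g k (c k).
  by move=> sI; apply: le_trans (kmax j isT); exact: (cP j).2.
have tI : t \in `[0, t] by rewrite in_itv/= lexx ltW.
have -> : e = eps * t by rewrite /eps divfK// gt_eqF.
rewrite -lerBlDr mulrC; apply: le_trans (gmax i t tI) _.
have := (cP k).1; rewrite in_itv/= => /andP[].
rewrite le_eqVlt => /predU1P[<- _|ck0 ckt].
  by rewrite /g mulr0 expR0 mul1r mulr0 subr0.
exfalso; have [dgk dgkE] := dg k _ ck0.
have : 0 <= 'D_1 (g k) (c k).
  apply: derive_at_left_max ck0 dgk _ => s /andP[s0 sc].
  by apply: (cP k).2; rewrite in_itv/= !ltW// (lt_le_trans sc).
rewrite dgkE leNgt => /negP; apply.
rewrite subr_lt0; apply: le_lt_trans eps0.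
rewrite pmulr_rle0 ?expR_gt0// addrC -lerBrDr sub0r -mulNr.
(* At the common time [c k] the weight and the tilt do not depend on the index, so joint maximality
   makes [u k] the largest of the [u j] there. *)
apply: decay => // j.
have : g j (c k) <= g k (c k) by apply: gmax; rewrite in_itv/= ckt ltW.
by rewrite /g lerD2r ler_pM2l ?expR_gt0.
Qed.

(** * Maximum principle and resolvents of a Laplacian matrix *)

Lemma laplacian_mul_ones (R : realType) (n : nat) (L : 'M[R]_n) :
  laplacian L -> L *m ones = 0.
Proof.
move=> [_ L0]; apply/colP => i; rewrite !mxE -[RHS](L0 i).
by apply: eq_bigr => j _; rewrite mxE mulr1.
Qed.

(** Since rows sum to zero, [y i] can be subtracted from every entry; then each off-diagonal term is
    a product of two nonpositive numbers. *)
Lemma laplacian_mul_max (R : realType) (n : nat) (L : 'M[R]_n) (y : 'cV[R]_n) i :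
  laplacian L -> (forall k, y k ord0 <= y i ord0) -> 0 <= (L *m y) i ord0.
Proof.
move=> [Lle0 Lsum] ymax.
have -> : (L *m y) i ord0 = \sum_j L i j * (y j ord0 - y i ord0).
  rewrite mxE; under [RHS]eq_bigr do rewrite mulrBr.
  by rewrite sumrB -mulr_suml Lsum mul0r subr0.
apply: sumr_ge0 => j _; have [->|ij] := eqVneq i j.
  by rewrite subrr mulr0.
by rewrite mulr_le0 ?Lle0 ?subr_le0.
Qed.

(** At an index maximizing [y], the term [a *: (L *m y)] is nonnegative, so adding it cannot lower
    the largest entry. *)
Lemma laplacian_max_principle (R : realType) (n : nat) (L : 'M[R]_n)
    (y : 'cV[R]_n) (a C : R) : laplacian L -> 0 <= a ->
  (forall i, (y + a *: (L *m y)) i ord0 <= C) -> forall i, y i ord0 <= C.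
Proof.
move=> lapL a0 yC i.
have [/= k _ kmax] := @arg_maxP _ _ _ i xpredT (fun k => y k ord0) isT.
apply: le_trans (kmax i isT) _; apply: le_trans (yC k).
rewrite !mxE lerDl mulr_ge0//.
have := laplacian_mul_max _ _ L y k lapL (fun j => kmax j isT).
by rewrite mxE.
Qed.

Lemma laplacian_norm_principle (R : realType) (n : nat) (L : 'M[R]_n)
    (y : 'cV[R]_n) (a C : R) : laplacian L -> 0 <= a ->
  (forall i, `|(y + a *: (L *m y)) i ord0| <= C) ->
  forall i, `|y i ord0| <= C.
Proof.
move=> lapL a0 yC i; rewrite ler_norml lerNl; apply/andP; split.
  have := @laplacian_max_principle _ _ L (- y) a C lapL a0 _ i.
  rewrite !mxE; apply => j; apply: le_trans (yC j).
  by rewrite mulmxN scalerN -opprD mxE -[leRHS]normrN ler_norm.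
apply: (laplacian_max_principle _ _ L y a) => // j.
exact: le_trans (ler_norm _) (yC j).
Qed.

(** The norm bound with [C = 0] makes the null space trivial; the transposes turn the left kernel
    [kermx] into a null space of columns. *)
Lemma laplacian_resolvent_unit (R : realType) (n : nat) (L : 'M[R]_n) (a : R) :
  laplacian L -> 0 <= a -> 1%:M + a *: L \in unitmx.
Proof.
move=> lapL a0; rewrite -unitmx_tr -row_free_unit -kermx_eq0.
apply/rowV0P => z /sub_kermxP zker.
apply: trmx_inj; apply/colP => i; apply/eqP.
rewrite trmx0 [X in _ == X]mxE -normr_le0.
apply: (@laplacian_norm_principle _ _ L z^T a) => // j.
have -> : z^T + a *: (L *m z^T) = (1%:M + a *: L) *m z^T.
  by rewrite mulmxDl mul1mx scalemxAl.
by rewrite -[_ *m _]trmxK trmx_mul trmxK zker trmx0 mxE normr0.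
Qed.

Lemma resolventE (R : realType) (n : nat) (L : 'M[R]_n) (a : R) :
  1%:M + a *: L \in unitmx ->
  a *: (invmx (1%:M + a *: L) *m L) = 1%:M - invmx (1%:M + a *: L).
Proof.
move=> u; apply/eqP; rewrite -subr_eq0 opprB addrA subr_eq0 -{3}(mulVmx u).
by rewrite mulmxDr mulmx1 -scalemxAr addrC.
Qed.

Lemma resolvent_norm (R : realType) (n : nat) (L : 'M[R]_n) (a C : R)
    (b : 'cV[R]_n) : laplacian L -> 0 <= a ->
  (forall i, `|b i ord0| <= C) ->
  forall i, `|(invmx (1%:M + a *: L) *m b) i ord0| <= C.
Proof.
move=> lapL a0 bC; apply: (laplacian_norm_principle _ _ L _ a) => // i.
rewrite scalemxAl -{1}[_ *m b]mul1mx -mulmxDl mulKVmx//.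
exact: laplacian_resolvent_unit.
Qed.

Lemma resolvent_fixed (R : realType) (n : nat) (L : 'M[R]_n) (a : R)
    (y : 'cV[R]_n) : 1%:M + a *: L \in unitmx -> L *m y = 0 ->
  invmx (1%:M + a *: L) *m y = y.
Proof.
move=> u Ly; rewrite -[in LHS](_ : (1%:M + a *: L) *m y = y) ?mulKmx//.
by rewrite mulmxDl mul1mx -scalemxAl Ly scaler0 addr0.
Qed.

(* With [a] = 1 / delta, the resolvent maps [L z] to [delta (z - w)] where [w] is
   bounded independently of delta. *)
Lemma cvg_resolvent_range (R : realType) (n : nat) (L : 'M[R]_n)
    (z : 'cV[R]_n) : laplacian L ->
  invmx (1%:M + delta^-1 *: L) *m (L *m z) @[delta --> 0^'+] --> (0 : 'cV[R]_n).
Proof.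
move=> lapL; apply: cvg_mx => i j; rewrite (ord1 j) [X in _ --> X]mxE.
(* [C] is the sup norm of [z], which the resolvents do not increase; hence the bound [d * (C + C)]
   below. *)
pose C := \big[Num.max/0]_k `|z k ord0|.
have zC k : `|z k ord0| <= C by exact: le_bigmax.
apply/norm_cvg0P; apply: (@squeeze_cvgr _ _ _ _ (fun=> 0) (fun d => d * (C + C))).
- near=> d; have d0 : 0 < d by [].
  have u : 1%:M + d^-1 *: L \in unitmx.
    by apply: laplacian_resolvent_unit => //; rewrite invr_ge0 ltW.
  rewrite normr_ge0/= mulmxA.
  have -> : invmx (1%:M + d^-1 *: L) *m L
      = d *: (1%:M - invmx (1%:M + d^-1 *: L)).
    by rewrite -resolventE// scalerA divff ?gt_eqF// scale1r.
  rewrite -scalemxAl mulmxBl mul1mx.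
  rewrite mxE normrM gtr0_norm// ler_pM2l// mxE.
  apply: le_trans (ler_normD _ _) _; rewrite lerD// mxE normrN.
  by apply: resolvent_norm => //; rewrite invr_ge0 ltW.
- exact: cvg_cst.
- rewrite -[X in _ --> X](mul0r (C + C)); apply: cvgMl.
  by apply: cvg_at_right_filter; exact: cvg_id.
Unshelve. all: by end_near. Qed.

(** * Null spaces of powers and the limit of the resolvents *)

(** The resolvents send [L *m y] to 0 in the limit, yet fix it when it lies in the null space;
    limits are unique. *)
Lemma laplacian_ker_sqr (R : realType) (n : nat) (L : 'M[R]_n)
    (y : 'cV[R]_n) : laplacian L -> L *m (L *m y) = 0 -> L *m y = 0.
Proof.
move=> lapL LLy.
have := cvg_resolvent_range _ _ L y lapL => /(cvg_lim (@norm_hausdorff _ _)) <-.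
apply/esym/(cvg_lim (@norm_hausdorff _ _)).
apply: cvg_near_cst; near=> d; have d0 : 0 < d by [].
apply: resolvent_fixed => //; apply: laplacian_resolvent_unit => //.
by rewrite invr_ge0 ltW.
Unshelve. all: by end_near. Qed.

Lemma laplacian_ker_pow (R : realType) (n : nat) (L : 'M[R]_n) k
    (y : 'cV[R]_n) : laplacian L -> L ^+ k *m y = 0 -> L *m y = 0.
Proof.
move=> lapL; elim: k => [|[//|k] IH]; first by rewrite mul1mx => ->; rewrite mulmx0.
rewrite !exprS -!mulmxE -!mulmxA => /(laplacian_ker_sqr _ _ _ _ lapL) H.
by apply: IH; rewrite exprS -mulmxE -mulmxA.
Qed.

(** Only index 0 needs care: there [A ^+ 0] is the identity, and equality of ranks makes [A]
    invertible. *)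
Lemma mxindex_range (F : fieldType) (n : nat) (A : 'M[F]_n) (y : 'cV[F]_n) :
  exists z, A ^+ mxindex A *m y = A *m z.
Proof.
rewrite /mxindex; case: ex_minnP => -[|k] /eqP rk _; last first.
  by exists (A ^+ k *m y); rewrite exprS -mulmxE mulmxA.
have uA : A \in unitmx.
  by rewrite -row_free_unit /row_free -[A]expr1 rk expr0 mxrank1.
by exists (invmx A *m y); rewrite mulKVmx// mul1mx.
Qed.

(** Split [x0] as [J *m x0] plus a vector [L *m z]: the resolvents fix the first summand and tend to
    0 on the second. *)
Lemma cvg_resolvent_eigenprojection (R : realType) (n : nat) (L J : 'M[R]_n)
    (x0 : 'cV[R]_n) : laplacian L -> eigenprojection L J ->
  invmx (1%:M + delta^-1 *: L) *m x0 @[delta --> 0^'+] --> J *m x0.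
Proof.
move=> lapL [JJ rJ nJ].
have LJ : L *m (J *m x0) = 0.
  have : mxrange J (J *m x0) by exists x0.
  by rewrite rJ; exact: laplacian_ker_pow.
have [z xz] : exists z, x0 - J *m x0 = L *m z.
  have : mxnull J (x0 - J *m x0).
    by rewrite /mxnull/= mulmxBr mulmxA JJ subrr.
  by rewrite nJ => -[y _ <-]; exact: mxindex_range.
rewrite -[X in _ --> X]addr0.
apply: cvg_trans (cvgD (cvg_cst (J *m x0)) (cvg_resolvent_range _ _ L z lapL)).
apply: near_eq_cvg; near=> d; have d0 : 0 < d by [].
rewrite fctE -xz mulmxBr (resolvent_fixed _ _ L _ (J *m x0)) //.
  by rewrite addrC subrK.
by apply: laplacian_resolvent_unit => //; rewrite invr_ge0 ltW.
Unshelve. all: by end_near. Qed.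

(** * Solutions of the differential equation: continuity, invariants, spread *)

(** For [h > 0], [x h] is [h] times the right difference quotient at 0, plus [x 0]. *)
Lemma linear_ode_cvg0 (R : realType) (n : nat) (M : 'M[R]_n)
    (x0 : 'cV[R]_n) (x : R -> 'cV[R]_n) :
  linear_ode_solution M x0 x -> x s @[s --> 0^'+] --> x 0.
Proof.
move=> [_ dx0 _].
have h0 : (h : R) @[h --> 0^'+] --> (0 : R).
  by apply: cvg_at_right_filter; exact: cvg_id.
rewrite -[X in _ --> X]add0r -(scale0r (M *m x 0)).
apply: cvg_trans (cvgD (cvgZ h0 dx0) (cvg_cst (x 0))); apply: near_eq_cvg.
near=> h; have hp : 0 < h by [].
by rewrite fctE scalerA divff ?gt_eqF// scale1r subrK.
Unshelve. all: by end_near. Qed.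

Lemma is_derive_entry (R : realType) (n : nat) (x : R -> 'cV[R]_n)
    (dx : 'cV[R]_n) (t : R) i :
  is_derive t 1 x dx -> is_derive t 1 (fun s => x s i ord0) (dx i ord0).
Proof.
move=> [xt <-]; rewrite derive_mx// mxE; apply: DeriveDef => //.
by move/derivable_mxP : xt; exact.
Qed.

(** The derivative of [w *m x t] vanishes, and the decay bound at rate 0 over a one-point index type
    turns this into an inequality with the initial value. The factor [c], taken as 1 and -1, gives
    both directions. *)
Lemma linear_ode_invariant (R : realType) (n : nat) (M : 'M[R]_n)
    (x0 : 'cV[R]_n) (x : R -> 'cV[R]_n) (w : 'rV[R]_n) :
  linear_ode_solution M x0 x -> w *m M = 0 ->
  forall t : R, 0 <= t -> w *m x t = w *m x0.
Proof.
move=> sol wM t t0; apply/rowP => j; rewrite (ord1 j) {j}.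
have dx (c s : R) : 0 < s ->
    is_derive s 1 (fun r => c * (w *m x r) ord0 ord0) 0.
  move=> s0; have [_ _ /(_ s s0) dxs] := sol.
  have dxi i := is_derive_entry _ _ _ _ _ i dxs.
  have -> : (fun r => c * (w *m x r) ord0 ord0) =
      c \*: \sum_i (w ord0 i \*: (fun r => x r i ord0)).
    by apply/funext => r; rewrite mxE fct_sumE.
  apply: is_derive_eq.
  transitivity (c * (w *m (M *m x s)) ord0 ord0).
    by rewrite [in RHS]mxE.
  by rewrite mulmxA wM mul0mx mxE mulr0.
have x00 c : c * (w *m x r) ord0 ord0 @[r --> 0^'+] --> c * (w *m x 0) ord0 ord0.
  by apply: cvgMr; apply: cvg_entry; apply: cvg_mulmx; exact: linear_ode_cvg0 sol.
have le c : c * (w *m x t) ord0 ord0 <= c * (w *m x 0) ord0 ord0.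
  have := @max_expR_decay R unit (fun _ r => c * (w *m x r) ord0 ord0)
    (fun _ _ => 0) 0 _ (fun _ => x00 c) (fun _ => dx c) _ (fun _ => lexx _) tt t t0.
  by rewrite oppr0 mul0r expR0 mulr1; apply => *; rewrite mul0r.
have [<- _ _] := sol; apply/eqP; rewrite eq_le.
have := le 1; rewrite !mul1r => ->.
by have := le (-1); rewrite !mulN1r lerN2.
Qed.

(** Pairs [(i, j)] serve as indices in the decay bound. At a pair of largest difference, the first
    entry of [x t] is maximal and the second minimal, so the [L] terms have the right signs; the [v]
    terms cancel, leaving the rate [delta]. *)
Lemma spread_decay (R : realType) (n : nat) (L : 'M[R]_n) (v x0 : 'cV[R]_n)
    (delta : R) (x : R -> 'cV[R]_n) :
  laplacian L ->
  linear_ode_solution (- (L + delta *: (1%:M - ones *m v^T))) x0 x ->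
  exists C, forall i j (t : R), 0 <= t ->
  x t i ord0 - x t j ord0 <= C * expR (- delta * t).
Proof.
move=> lapL sol.
pose I := ('I_n * 'I_n)%type.
pose u (p : I) t := x t p.1 ord0 - x t p.2 ord0.
pose dx t := - (L + delta *: (1%:M - ones *m v^T)) *m x t.
exists (\big[Num.max/0]_p (u p 0)) => i j t t0.
apply: (max_expR_decay _ _ u (fun p t => dx t p.1 ord0 - dx t p.2 ord0)
  delta _ _ _ _ _ (i, j) t t0).
- by move=> p; apply: cvgB; apply: cvg_entry; exact: linear_ode_cvg0 sol.
- move=> p s s0; have [_ _ /(_ s s0) dxs] := sol.
  have dxi k := is_derive_entry _ _ _ _ _ k dxs.
  by apply: is_deriveB.
- move=> [k l] s s0 kl_max; rewrite /u /=.
  have Lk : 0 <= (L *m x s) k ord0.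
    apply: laplacian_mul_max => // m.
    by have := kl_max (m, l); rewrite /u/= lerD2r.
  have Ll : 0 <= (L *m - x s) l ord0.
    apply: laplacian_mul_max => // m; rewrite 2!mxE.
    by have := kl_max (k, m); rewrite /u/= lerD2l.
  have dxE m : dx s m ord0 = - (L *m x s) m ord0
      - delta * (x s m ord0 - (v^T *m x s) ord0 ord0).
    rewrite /dx mulNmx mulmxDl -scalemxAl mulmxBl mul1mx -mulmxA !mxE big_ord1.
    by rewrite !mxE mul1r opprD.
  move: Ll; rewrite mulmxN mxE !dxE => Ll.
  by lra.
- by move=> p; exact: (le_bigmax _ (fun p => u p 0)).
Qed.

(** * The conserved row and the two limits *)

Lemma limit_row_ones (R : realType) (n : nat) (L : 'M[R]_n) (v : 'cV[R]_n)
    (delta : R) :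
  laplacian L -> 0 < delta -> \sum_i v i ord0 = 1 ->
  v^T *m invmx (1%:M + delta^-1 *: L) *m ones = 1%:M.
Proof.
move=> lapL d0 v_sum1; rewrite -mulmxA resolvent_fixed; first last.
- exact: laplacian_mul_ones.
- by apply: laplacian_resolvent_unit => //; rewrite invr_ge0 ltW.
apply/rowP => j; rewrite (ord1 j) !mxE eqxx -[RHS]v_sum1.
by apply: eq_bigr => i _; rewrite !mxE mulr1.
Qed.

(** The matrix [L + delta D] is [delta] times the difference of [I + L / delta] and [ones *m v^T],
    and the row sends both of these to [v^T]. *)
Lemma limit_row_invariant (R : realType) (n : nat) (L : 'M[R]_n) (v : 'cV[R]_n)
    (delta : R) :
  laplacian L -> 0 < delta -> \sum_i v i ord0 = 1 ->
  v^T *m invmx (1%:M + delta^-1 *: L) *m 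
    - (L + delta *: (1%:M - ones *m v^T)) = 0.
Proof.
move=> lapL d0 v_sum1.
have u : 1%:M + delta^-1 *: L \in unitmx.
  by apply: laplacian_resolvent_unit => //; rewrite invr_ge0 ltW.
rewrite mulmxN; apply/eqP; rewrite oppr_eq0; apply/eqP.
have -> : L + delta *: (1%:M - ones *m v^T) =
    delta *: ((1%:M + delta^-1 *: L) - ones *m v^T).
  rewrite addrAC [in RHS]scalerDr scalerA divff ?gt_eqF// scale1r.
  exact: addrC.
rewrite -scalemxAr mulmxBr mulmxKV// mulmxA limit_row_ones// mul1mx subrr.
exact: scaler0.
Qed.

Lemma control_cvg (R : realType) (n : nat) (L : 'M[R]_n) (v x0 : 'cV[R]_n)
    (delta : R) (x : R -> 'cV[R]_n) :
  laplacian L -> 0 < delta -> \sum_i v i ord0 = 1 ->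
  linear_ode_solution (- (L + delta *: (1%:M - ones *m v^T))) x0 x ->
  x t @[t --> +oo] --> ones *m v^T *m invmx (1%:M + delta^-1 *: L) *m x0.
Proof.
move=> lapL d0 v_sum1 sol; set w := v^T *m invmx (1%:M + delta^-1 *: L).
have [C xC] := spread_decay _ _ _ _ _ _ _ lapL sol.
have wsum : \sum_j w ord0 j = 1.
  transitivity ((w *m (ones : 'cV[R]_n)) ord0 ord0).
    by rewrite [RHS]mxE; apply: eq_bigr => j _; rewrite [ones _ _]mxE mulr1.
  by rewrite limit_row_ones// mxE eqxx.
have wM := limit_row_invariant _ _ _ _ _ lapL d0 v_sum1.
rewrite -mulmxA -(mulmxA ones) (mulmxA v^T) -/w; rewrite -/w in wM.
clearbody w; apply: cvg_mx => i j; rewrite (ord1 j) {j}.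
rewrite [X in _ --> X]mxE big_ord1 [ones _ _]mxE mul1r.
have dist_le (t : R) : 0 <= t -> `|x t i ord0 - (w *m x0) ord0 ord0|
    <= (\sum_j `|w ord0 j|) * C * expR (- (delta * t)).
  (* Conservation replaces [w *m x0] by [w *m x t]. As [w] sums to 1, the deviation of [x_i] from it
     is the combination of the differences [x_i - x_j] with coefficients [w_j]. *)
  move=> t0; rewrite -(linear_ode_invariant _ _ _ _ _ _ sol wM t t0).
  rewrite mxE -[x t i ord0]mul1r -wsum mulr_suml -sumrB -mulrA mulr_suml.
  apply: le_trans (ler_norm_sum _ _ _) _; apply: ler_sum => j _.
  rewrite -mulrBr normrM ler_wpM2l// -mulNr ler_norml.
  by rewrite lerNl opprB !xC.
have exp0 : expR (- (delta * t)) @[t --> +oo] --> (0 : R).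
  apply: (cvg_comp _ (fun s => expR (- s)) _ (@cvgr_expR R)).
  by apply: gt0_cvgMry => //; exact: cvg_id.
apply/subr_cvg0/norm_cvg0P.
apply: (@squeeze_cvgr _ _ _ _ (fun=> 0)
  (fun t => (\sum_j `|w ord0 j|) * C * expR (- (delta * t)))).
- by near=> t; rewrite normr_ge0/= dist_le.
- exact: cvg_cst.
- by rewrite -[X in _ --> X](mulr0 ((\sum_j `|w ord0 j|) * C)); exact: cvgMr.
Unshelve. all: by end_near. Qed.

Theorem theorem3 (R : realType) (n : nat) (L J : 'M[R]_n) (v x0 : 'cV[R]_n)
    (L_laplacian : laplacian L)
    (J_eigenprojection : eigenprojection L J)
    (v_ge0 : forall i, 0 <= v i ord0)
    (v_sum1 : \sum_i v i ord0 = 1) :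
  let D := 1%:M - ones *m v^T in
  (forall (delta : R) (x : R -> 'cV[R]_n), 0 < delta ->
     linear_ode_solution (- (L + delta *: D)) x0 x ->
     1%:M + delta^-1 *: L \in unitmx /\
     x t @[t --> +oo] -->
       ones *m v^T *m invmx (1%:M + delta^-1 *: L) *m x0)
  /\
  (forall x : R -> R -> 'cV[R]_n,
     (forall delta : R, 0 < delta ->
        linear_ode_solution (- (L + delta *: D)) x0 (x delta)) ->
     lim (x delta t @[t --> +oo]) @[delta --> 0^'+] -->
       ones *m v^T *m J *m x0).
Proof.
move=> D; split=> [delta x d0 sol|x sol].
  split; last exact: control_cvg sol.
  by apply: laplacian_resolvent_unit => //; rewrite invr_ge0 ltW.
rewrite -mulmxA; apply: cvg_trans (cvg_mulmx _ _ _ _ _ _ _ _ _ _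
  (cvg_resolvent_eigenprojection _ _ _ _ _ L_laplacian J_eigenprojection)).
(* For each positive [d] the inner limit has the closed form of the first claim, so the outer limit
   is that of the resolvents. *)
apply: near_eq_cvg; near=> d.
have d0 : 0 < d by [].
rewrite (cvg_lim (@norm_hausdorff _ _)
  (control_cvg _ _ _ _ _ _ _ L_laplacian d0 v_sum1 (sol d d0))).
by rewrite mulmxA.
Unshelve. all: by end_near. Qed.
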